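(* Let $X$ and $Y$ be Polish spaces and let $f\colon X\to Y$ be an arbitrary function. The game $G''_f$ is determined (i.e. one of the two players has a winning strategy), and \begin{itemize} \item Player I has a winning strategy in $G''_f$ if and only if $f$ is not of Baire class 1; \item Player II has a winning strategy in $G''_f$ if and only if $f$ is of Baire class 1. \end{itemize}
   Context: A function $f\colon X\to Y$ between Polish spaces is of Baire class 1 if $f^{-1}[U]$ is $F_\sigma$ in $X$ for every open $U\subseteq Y$. The game $G''_f$: the players alternately play $x_0,U_0,x_1,U_1,x_2,U_2,\dots$, where Player I plays the points $x_n$ and Player II plays the sets $U_n$, with the rules: $x_0\in X$, and $x_n\in U_{n-1}$ for $n>0$; each $U_n$ is an open subset of $X$ with $x_n\in U_n$. Player II wins if $\langle x_n\rangle$ is convergent in $X$ and $\lim_{n\to\infty}f(x_n)=f(\lim_{n\to\infty}x_n)$ (in particular the limit on the left exists); otherwise Player I wins. The rules are binding: the first player who does not make a legal move loses. The Axiom of Choice is assumed. *)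

(* Defs.v *)
From HB Require Import structures.
From mathcomp Require Import all_boot all_order all_algebra.
From mathcomp Require Import boolp classical_sets functions cardinality reals.
From mathcomp Require Import topology normedtype sequences borel_hierarchy.

Set Implicit Arguments.
Unset Strict Implicit.
Unset Printing Implicit Defensive.

Import Order.TTheory GRing.Theory Num.Theory.

Local Open Scope classical_set_scope.
Local Open Scope ring_scope.

Definition separable_space (X : topologicalType) : Prop :=
  exists2 D : set X, countable D & dense D.

Definition is_metric (R : realType) (X : Type) (d : X -> X -> R) : Prop :=
  [/\ forall x y, 0 <= d x y,
      forall x y, d x y = 0 <-> x = y,
      forall x y, d x y = d y x
    & forall x y z, d x z <= d x y + d y z].

Definition metric_compatible (R : realType) (X : topologicalType)
    (d : X -> X -> R) : Prop :=
  forall U : set X, open U <->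
    (forall x, U x -> exists2 e : R, 0 < e & [set y | d x y < e] `<=` U).

Definition metric_complete (R : realType) (X : topologicalType)
    (d : X -> X -> R) : Prop :=
  forall u : nat -> X,
    (forall e : R, 0 < e ->
       exists N, forall m n, (N <= m)%N -> (N <= n)%N -> d (u m) (u n) < e) ->
    exists l : X, u @ \oo --> l.

(* [completeType] is pointed, and [completeType] and [metricType] fix a uniformity;
   here the metric is existentially quantified, so that being Polish is a
   property of the topology alone, and the empty space is Polish. *)
Definition polish_space (R : realType) (X : topologicalType) : Prop :=
  separable_space X /\
  exists d : X -> X -> R,
    [/\ is_metric d, metric_compatible d & metric_complete d].

Definition baire_class1 (X Y : topologicalType) (f : X -> Y) : Prop :=
  forall U : set Y, open U -> Fsigma (f @^-1` U).

(* A run x_0, U_0, x_1, U_1, ... is a pair of sequences [x] and [U], not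
   necessarily of legal moves. *)
Section Game.
Variables (X Y : topologicalType) (f : X -> Y).
Implicit Types (x : nat -> X) (U : nat -> set X) (n : nat).

Definition legal_I x U n : Prop :=
  if n is k.+1 then U k (x n) else True.

Definition legal_II x U n : Prop := open (U n) /\ U n (x n).

Definition legal_run x U : Prop :=
  forall n, legal_I x U n /\ legal_II x U n.

Definition legal_before x U n : Prop :=
  forall m, (m < n)%N -> legal_I x U m /\ legal_II x U m.

Definition first_fault_I x U : Prop :=
  exists2 n, legal_before x U n & ~ legal_I x U n.

Definition first_fault_II x U : Prop :=
  exists2 n, legal_before x U n & legal_I x U n /\ ~ legal_II x U n.

Definition payoff_II x : Prop :=
  exists2 l : X, x @ \oo --> l & (f \o x) @ \oo --> f l.

Definition wins_II x U : Prop :=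
  first_fault_I x U \/ legal_run x U /\ payoff_II x.

Definition wins_I x U : Prop :=
  first_fault_II x U \/ legal_run x U /\ ~ payoff_II x.

(* A strategy reads the list of the opponent's previous moves, oldest first.
   If [X] is empty then Player I has no first move, and accordingly no
   strategy, while every strategy of Player II is vacuously winning. *)
Definition strategy_I := seq (set X) -> X.
Definition strategy_II := seq X -> set X.

Definition winning_I (s : strategy_I) : Prop :=
  forall U, wins_I (fun n => s (mkseq U n)) U.

Definition winning_II (t : strategy_II) : Prop :=
  forall x, wins_II x (fun n => t (mkseq x n.+1)).

Definition has_winning_I : Prop := exists s : strategy_I, winning_I s.
Definition has_winning_II : Prop := exists t : strategy_II, winning_II t.

Definition determined : Prop := has_winning_I \/ has_winning_II.

End Game.

(* Main.v *)
Require Import Defs.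
From mathcomp Require Import all_boot all_order all_algebra.
From mathcomp Require Import boolp classical_sets reals topology.
From mathcomp Require Import cardinality borel_hierarchy.
From mathcomp Require Import lra.

(** The link between the game and Baire class 1 is a countable family of closed
    subsets of [X], a closed network, such that every preimage of an open set
    is a union of members of the family. As [Y] has a countable base, [f] is of
    Baire class 1 exactly when it has a closed network ([baire1_network],
    [network_baire1]).

    Suppose that [C 0, C 1, ...] is a closed network. Player II answers [x n]
    with a small open set whose closure lies in the previous answer, and which
    avoids every [C j] with [j <= n] that does not contain [x n]. By
    completeness the [x n] converge to a point [l] that lies in every answer.
    So if [l] is in [C j], then [x n] is in [C j] for every [n >= j], as
    otherwise the answer to [x n] would have avoided [C j] and could not contain
    [l]. Since every neighbourhood of [f l] contains the image of some [C j]
    with [l] in it, [f (x n)] tends to [f l] ([closed_network_winning_II]).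

    Suppose that [f] is not of Baire class 1. Then there are [e > 0] and a
    nonempty closed set [F] such that [f] oscillates by more than [e] on every
    nonempty relatively open subset of [F]. Player I stays in [F] and moves each
    time to a point whose image is at distance more than [e / 2] from the
    image of the previous one, so that the images do not converge
    ([large_osc_winning_I]). To see that such [e] and [F] exist, suppose that
    for a given [e] every nonempty closed set has a nonempty relatively open
    subset on which [f] oscillates by at most [e]. Let [W] be the union of the
    basic open sets that split into countably many closed sets of oscillation at
    most [e]. Then [W] splits too, and the hypothesis applied to the complement
    of [W] shows that [W] is everything ([closed_pieces_setT]). Doing so for
    all [e = 1 / (n + 1)] gives a closed network ([small_osc_network]).

    The players cannot both have a winning strategy, since the two strategies
    could be played against each other ([not_both_winning]); with the two
    constructions above this gives determinacy and both equivalences. *)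

Set Implicit Arguments.
Unset Strict Implicit.
Unset Printing Implicit Defensive.

Import Order.TTheory GRing.Theory Num.Theory.

Local Open Scope classical_set_scope.
Local Open Scope ring_scope.

(** * Countable families of sets *)

Lemma countable_range (T : Type) (u : nat -> T) : countable (range u).
Proof. exact: sub_countable (card_image_le _ _) (countableP _). Qed.

(** Since an empty family has no enumeration, the sequence is allowed to take
    the value [set0], which is harmless both in unions of closed sets and among
    the sets that Player II avoids. *)
Lemma countable_family_seq (T : Type) (N : set (set T)) : countable N ->
  exists u : nat -> set T,
    (forall C, N C -> exists i, u i = C) /\ (forall i, N (u i) \/ u i = set0).
Proof.
move=> /countable_injP[g ginj].
have [i|u uP] := @choice nat (set T)
    (fun i C => (N C /\ g C = i) \/ (C = set0 /\ forall A, N A -> g A <> i)).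
  case: (pselect (exists C, N C /\ g C = i)) => [[C NC]|noC].
    by exists C; left.
  by exists set0; right; split=> // A NA gA; apply: noC; exists A.
exists u; split=> [C NC|i]; last by case: (uP i) => -[]; [left|right].
exists (g C); case: (uP (g C)) => [[Nu]|[_ /(_ _ NC)//]].
by apply: ginj; rewrite inE.
Qed.

Section Pieces.
Variable X : topologicalType.
Implicit Types (A B U W : set X) (N : set (set X)) (P : set X -> Prop).

Lemma Fsigma_countable_family N : countable N -> (forall C, N C -> closed C) ->
  Fsigma (\bigcup_(C in N) C).
Proof.
move=> /countable_family_seq[u [Nu uN]] Ncl; exists u.
  by move=> i; case: (uN i) => [/Ncl//|->]; exact: closed0.
rewrite predeqE => x; split=> [[C /Nu[i <-] ux]|[i _ ux]]; first by exists i.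
by case: (uN i) => [Nui|ui0]; [exists (u i)|rewrite ui0 in ux].
Qed.

Definition closed_pieces P A : Prop :=
  exists N, [/\ countable N, forall C, N C -> closed C /\ P C
              & A = \bigcup_(C in N) C].

Lemma closed_pieces_bigcup (I : Type) (D : set I) (A : I -> set X) P :
  countable D -> (forall i, D i -> closed_pieces P (A i)) ->
  closed_pieces P (\bigcup_(i in D) A i).
Proof.
move=> cD pA.
have [i|N NP] := @choice I (set (set X)) (fun i N => D i ->
    [/\ countable N, forall C, N C -> closed C /\ P C & A i = \bigcup_(C in N) C]).
  case: (pselect (D i)) => [/pA[N Ni]|nD]; first by exists N.
  by exists set0.
exists (\bigcup_(i in D) N i); split.
- by apply: bigcup_countable => // i /NP[].
- by move=> C [i Di NC]; have [_ /(_ _ NC)] := NP _ Di.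
- rewrite predeqE => x; split=> [[i Di]|[C [i Di NiC] Cx]].
    have [_ _ ->] := NP _ Di => -[C NC Cx].
    by exists C => //; exists i.
  by exists i => //; have [_ _ ->] := NP _ Di; exists C.
Qed.

(** The Fsigma decomposition of [B] cuts the closed set [A] into closed pieces;
    they inherit [P] from [A `&` B], which is not itself closed. *)
Lemma closed_pieces_setI P A B : (forall C D, C `<=` D -> P D -> P C) ->
  closed A -> P (A `&` B) -> Fsigma B -> closed_pieces P (A `&` B).
Proof.
move=> Psub cA PAB [F cF BF]; exists (range (fun i => A `&` F i)); split.
- exact: countable_range.
- move=> _ [i _ <-]; split; first by apply: closedI.
  by apply: Psub PAB; apply: setIS; rewrite BF; exact: bigcup_sup.
- rewrite BF setI_bigcupr predeqE => x; split=> [[i _ ?]|[_ [i _ <-] ?]].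
    by exists (A `&` F i) => //; exists i.
  by exists i.
Qed.

Definition is_base (B : set (set X)) : Prop :=
  (forall b, B b -> open b) /\
  forall U x, open U -> U x -> exists b, [/\ B b, b x & b `<=` U].

(** A Cantor-Bendixson exhaustion with no transfinite induction: instead of
    removing relatively open sets one after the other, take at once the union
    [W] of all basic open sets that have a decomposition. There are countably
    many of them, so [W] has one as well. If [W] were not the whole space, some
    relatively open part of its complement would satisfy [P], and a basic
    neighbourhood [b] of a point of that part would have a decomposition, being
    the union of [W `&` b] and [~` W `&` b]; but then [b] would be inside
    [W]. *)
Lemma closed_pieces_setT P (B : set (set X)) :
    countable B -> is_base B -> (forall U, open U -> Fsigma U) ->
    (forall C D, C `<=` D -> P D -> P C) ->
    (forall F, closed F -> F !=set0 ->
       exists U, [/\ open U, F `&` U !=set0 & P (F `&` U)]) ->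
  closed_pieces P [set: X].
Proof.
move=> cB [Bo Bbase] oF Psub Pfrag.
pose G := [set b | B b /\ closed_pieces P b].
pose W := \bigcup_(b in G) b.
have pW : closed_pieces P W.
  apply: closed_pieces_bigcup => [|b []//].
  by apply: sub_countable cB; apply: subset_card_le => b [].
have oW : open W by apply: bigcup_open => b [/Bo].
suff -> : [set: X] = W by [].
apply/seteqP; split=> // x _; apply: contrapT => nWx.
have [U [oU [y [nWy Uy]] PU]] := Pfrag _ (open_closedC oW) (ex_intro _ x nWx).
have [b [Bb xb bU]] := Bbase _ _ oU Uy.
apply: (nWy); exists b => //; split=> //.
have -> : b = \bigcup_(c in [set: bool]) if c then W `&` b else ~` W `&` b.
  rewrite predeqE => z; split=> [bz|[[] _ []//]].
  by case: (pselect (W z)) => [Wz|nWz]; [exists true|exists false].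
apply: closed_pieces_bigcup => [|[] _]; first exact: countableP.
- have [N [cN NP ->]] := pW; rewrite setI_bigcupl.
  apply: closed_pieces_bigcup => // C /NP[cC PC].
  apply: closed_pieces_setI => //; last exact/oF/Bo.
  exact: Psub PC.
- apply: closed_pieces_setI => //; last exact/oF/Bo.
    exact: open_closedC.
  by apply: Psub PU; exact: setIS.
Qed.

End Pieces.

(** * Metrizable spaces *)

Section Metric.
Variables (R : realType) (X : topologicalType) (d : X -> X -> R).
Hypotheses (dm : is_metric d) (dc : metric_compatible d).

Definition mball (x : X) (e : R) : set X := [set y | d x y < e].

Lemma mball_center x e : 0 < e -> mball x e x.
Proof. by case: dm => _ /(_ x x)[_ /(_ erefl) dxx] _ _; rewrite /mball/= dxx. Qed.

Lemma open_mball x e : open (mball x e).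
Proof.
apply/dc => y xy; exists (e - d x y); first by rewrite subr_gt0.
move=> z /= yz; have [_ _ _ /(_ x y z)] := dm.
by rewrite /mball/=; lra.
Qed.

Lemma nbhs_mball x e : 0 < e -> nbhs x (mball x e).
Proof.
by move=> e0; apply: open_nbhs_nbhs; split; [exact: open_mball|exact: mball_center].
Qed.

Lemma open_shrink (V : set X) x : open V -> V x ->
  exists W, [/\ open W, W x & closure W `<=` V].
Proof.
move=> /dc/[apply] -[e e0 eV]; exists (mball x (e / 2)); split.
- exact: open_mball.
- by apply: mball_center; lra.
- move=> y /(_ _ (@nbhs_mball y (e / 2) _))[|z]; first by lra.
  move=> -[]; rewrite /mball/= => xz yz; apply: eV => /=.
  have [_ _ /(_ y z) + /(_ x z y)] := dm.
  lra.
Qed.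

Lemma natSinv_small (e : R) : 0 < e -> exists n : nat, n.+1%:R^-1 < e.
Proof. by move=> /ltr_add_invr[n]; rewrite add0r; exists n. Qed.

(** The [n]-th closed set consists of the points at distance at least
    [1 / (n + 1)] from the complement of [U]. *)
Lemma open_Fsigma (U : set X) : open U -> Fsigma U.
Proof.
move=> oU; exists (fun n => ~` \bigcup_(z in ~` U) mball z n.+1%:R^-1).
  by move=> n; apply: open_closedC; apply: bigcup_open => z _; exact: open_mball.
rewrite predeqE => x; split=> [Ux|[n _ nx]].
  have [e e0 eU] := (dc U).1 oU _ Ux.
  have [n ne] := natSinv_small e0; exists n => // -[z nUz].
  rewrite /mball/= => zx; apply/nUz/eU => /=.
  by case: dm => _ _ -> _; apply: lt_trans ne.
apply: contrapT => nUx; apply: nx; exists x => //.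
by apply: mball_center; rewrite invr_gt0 ltr0n.
Qed.

Lemma metric_countable_base : separable_space X ->
  exists B : set (set X), countable B /\ is_base B.
Proof.
move=> [D cD dD].
exists (\bigcup_(x in D) range (fun n => mball x n.+1%:R^-1)); split.
  by apply: bigcup_countable => // x _; exact: countable_range.
split=> [_ [x _ [n _ <-]]|U x oU Ux]; first exact: open_mball.
have [e e0 eU] := (dc U).1 oU _ Ux.
have e20 : 0 < e / 2 by lra.
have [n ne] := natSinv_small e20.
have n0 : 0 < n.+1%:R^-1 :> R by rewrite invr_gt0 ltr0n.
have [z [xz Dz]] := dD _ (ex_intro _ x (mball_center x n0)) (open_mball _ _).
have [_ _ dsym dtri] := dm.
exists (mball z n.+1%:R^-1); split; first by exists z => //; exists n.
  by rewrite /mball/= dsym.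
move=> y zy; apply: eU => /=; move: ne xz zy (dtri x z y).
rewrite /mball/=; move: n.+1%:R^-1 => r; lra.
Qed.

End Metric.

(** * Baire class 1 and networks of closed sets *)

Section Network.
Variables (X Y : topologicalType) (f : X -> Y).

Definition closed_network (N : set (set X)) : Prop :=
  [/\ countable N, forall C, N C -> closed C
    & forall V x, open V -> V (f x) -> exists C, [/\ N C, C x & C `<=` f @^-1` V]].

Lemma network_baire1 N : closed_network N -> baire_class1 f.
Proof.
move=> [cN Ncl Nnet] V oV.
have -> : f @^-1` V = \bigcup_(C in [set C | N C /\ C `<=` f @^-1` V]) C.
  rewrite predeqE => x; split=> [Vfx|[C [_ CV] /CV//]].
  by have [C [NC Cx CV]] := Nnet _ _ oV Vfx; exists C.
apply: Fsigma_countable_family => [|C [/Ncl]//].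
by apply: sub_countable cN; apply: subset_card_le => C [].
Qed.

Lemma baire1_network (B : set (set Y)) : countable B -> is_base B ->
  baire_class1 f -> exists N, closed_network N.
Proof.
move=> cB [Bo Bbase] bf.
have [b|F FP] := @choice (set Y) (nat -> set X) (fun b F => B b ->
    (forall i, closed (F i)) /\ f @^-1` b = \bigcup_i F i).
  case: (pselect (B b)) => [/Bo/bf[F cF bF]|nB]; first by exists F.
  by exists (fun=> set0).
exists (\bigcup_(b in B) range (F b)); split.
- by apply: bigcup_countable => // b _; exact: countable_range.
- by move=> _ [b Bb [i _ <-]]; exact: (FP _ Bb).1.
- move=> V x oV Vfx; have [b [Bb bfx bV]] := Bbase _ _ oV Vfx.
  have [cF bF] := FP _ Bb.
  have [i _ Fx] : (\bigcup_i F b i) x by rewrite -bF.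
  exists (F b i); split=> //; first by exists b => //; exists i.
  by move=> z Fz; apply: bV; rewrite -[b _]/((f @^-1` b) z) bF; exists i.
Qed.

End Network.

Section Oscillation.
Variables (R : realType) (X Y : topologicalType) (dY : Y -> Y -> R) (f : X -> Y).

Definition osc_le (e : R) (A : set X) : Prop :=
  forall x y, A x -> A y -> dY (f x) (f y) <= e.

(** Collect, for every [n], countably many closed sets of oscillation at most
    [1 / (n + 1)] that cover [X]. If [x] lies in such a set, the set is mapped
    into the ball of that radius around [f x], so these sets form a network. *)
Lemma small_osc_network (B : set (set X)) :
    countable B -> is_base B -> (forall U : set X, open U -> Fsigma U) ->
    metric_compatible dY ->
    (forall e, 0 < e -> forall F : set X, closed F -> F !=set0 ->
       exists U, [/\ open U, F `&` U !=set0 & osc_le e (F `&` U)]) ->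
  exists N, closed_network f N.
Proof.
move=> cB bB oF dc frag.
have [n|N NP] := @choice nat (set (set X)) (fun n N =>
    [/\ countable N, forall C, N C -> closed C /\ osc_le n.+1%:R^-1 C
      & [set: X] = \bigcup_(C in N) C]).
  apply: (closed_pieces_setT cB bB oF); last first.
    by apply: frag; rewrite invr_gt0 ltr0n.
  by move=> C D CD oD x y /CD Dx /CD; exact: oD.
exists (\bigcup_n N n); split.
- by apply: bigcup_countable => // n _; have [] := NP n.
- by move=> C [n _ NC]; have [_ /(_ _ NC)[]] := NP n.
- move=> V x oV Vfx; have [e e0 eV] := (dc V).1 oV _ Vfx.
  have [n ne] := natSinv_small e0.
  have [_ NCP NT] := NP n.
  have [C NC Cx] : (\bigcup_(C in N n) C) x by rewrite -NT.
  exists C; split=> //; first by exists n.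
  move=> z Cz; apply: eV => /=; apply: le_lt_trans ne.
  by have [_] := NCP _ NC; apply.
Qed.

End Oscillation.

(** * Runs of the game *)

Section Runs.
Variables (X Y : topologicalType) (f : X -> Y).

(** Reduces the analysis of a run to two questions: does the player following a
    strategy always move legally, and what happens in a fully legal run? *)
Lemma legal_run_or_first_fault (x : nat -> X) (U : nat -> set X) :
  legal_run x U \/
  exists2 n, legal_before x U n & ~ (legal_I x U n /\ legal_II x U n).
Proof.
case: (pselect (legal_run x U)) => [|nleg]; [by left|right].
have exn : exists n, `[< ~ (legal_I x U n /\ legal_II x U n) >].
  apply: contrapT => noN; apply: nleg => n; apply: contrapT => nn.
  by apply: noN; exists n; apply/asboolP.
case: (ex_minnP exn) => n /asboolP nn nmin.
exists n => // m mn; apply: contrapT => nm.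
by have := nmin m (asboolT nm); rewrite leqNgt mn.
Qed.

Lemma wins_I_intro x U :
  (forall n, legal_before x U n -> legal_I x U n) ->
  (legal_run x U -> ~ payoff_II f x) -> wins_I f x U.
Proof.
move=> leg pay; have [lr|[n bn nn]] := legal_run_or_first_fault x U.
  by right; split=> //; exact: pay.
left; exists n => //; split; first exact: leg.
by move=> n2; apply: nn; split=> //; exact: leg.
Qed.

Lemma wins_II_intro x U :
  (forall n, legal_before x U n -> legal_I x U n -> legal_II x U n) ->
  (legal_run x U -> payoff_II f x) -> wins_II f x U.
Proof.
move=> leg pay; have [lr|[n bn nn]] := legal_run_or_first_fault x U.
  by right; split=> //; exact: pay.
by left; exists n => // n1; apply: nn; split=> //; exact: leg.
Qed.

Lemma not_both_win_run x U : wins_I f x U -> ~ wins_II f x U.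
Proof.
case=> [[n bn [n1 n2]]|[lr np]] [[m bm m1]|[lr' p]] //.
- have [nm|mn|nm] := ltngtP n m.
  + by have [] := bm _ nm.
  + by have [/m1] := bn _ mn.
  + by apply: m1; rewrite -nm.
- by have [_ /n2] := lr' n.
- by have [/m1] := lr m.
Qed.

Lemma not_both_winning : has_winning_I f -> ~ has_winning_II f.
Proof.
move=> [s ws] [t wt].
(* [h n] lists the first [n] moves of each player when [s] plays against
   [t]. *)
pose h := fix h n : seq X * seq (set X) := if n is k.+1 then
    let xs := rcons (h k).1 (s (h k).2) in (xs, rcons (h k).2 (t xs))
  else ([::], [::]).
pose x n := s (h n).2.
pose U n := t (h n.+1).1.
have hE n : h n = (mkseq x n, mkseq U n).
  by elim: n => // n IH; rewrite !mkseqS /U /x /= IH.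
have xE : x = (fun n => s (mkseq U n)).
  by apply/funext => n; rewrite {1}/x hE.
have UE : U = (fun n => t (mkseq x n.+1)).
  by apply/funext => n; rewrite {1}/U hE.
apply: (@not_both_win_run x U).
  by rewrite {1}xE; exact: ws.
by rewrite {1}UE; exact: wt.
Qed.

End Runs.

(** * Winning strategies *)

Section WinII.
Variables (R : realType) (X Y : topologicalType) (f : X -> Y) (d : X -> X -> R).
Hypotheses (dm : is_metric d) (dc : metric_compatible d) (dcomp : metric_complete d).

(** The move of Player II at stage [n], in reply to [x], when [V] is the previous
    answer. Only finitely many closed sets are to be avoided, so the set to
    shrink is an open neighbourhood of [x]. *)
Lemma answer_II (C : nat -> set X) : (forall j, closed (C j)) ->
  forall n x (V : set X), open V -> V x -> exists W,
    [/\ open W, W x, closure W `<=` V, W `<=` mball d x n.+1%:R^-1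
      & forall y j, (j <= n)%N -> W y -> C j y -> C j x].
Proof.
move=> cC n x V oV Vx.
pose avoid := ~` \bigcup_(j in `I_n.+1 `&` [set j | ~ C j x]) C j.
have oA : open avoid.
  apply: closed_openC; apply: closed_bigcup => //.
  by apply: finite_setIl; exact: finite_II.
have Ax : avoid x by case=> j [].
pose V' := V `&` mball d x n.+1%:R^-1 `&` avoid.
have oV' : open V' by do 2?apply: openI => //; exact: open_mball.
have V'x : V' x.
  by split=> //; split=> //; apply: mball_center => //; rewrite invr_gt0 ltr0n.
have [W [oW Wx clW]] := open_shrink dm dc oV' V'x.
have WV' : W `<=` V' by apply: subset_trans clW; exact: subset_closure.
exists W; split=> //.
- by move=> y /clW[[]].
- by move=> y /WV'[[]].
- move=> y j jn /WV'[_ Ay] Cy; apply: contrapT => nCx.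
  by apply: Ay; exists j.
Qed.

Lemma closed_network_winning_II N : closed_network f N -> has_winning_II f.
Proof.
move=> [cN Ncl Nnet].
have [C [NC CN]] := countable_family_seq cN.
have cC j : closed (C j) by case: (CN j) => [/Ncl//|->]; exact: closed0.
have [p|W WP] := @choice (nat * X * set X) (set X) (fun p W =>
    open p.2 -> p.2 p.1.2 ->
    [/\ open W, W p.1.2, closure W `<=` p.2, W `<=` mball d p.1.2 p.1.1.+1%:R^-1
      & forall y j, (j <= p.1.1)%N -> W y -> C j y -> C j p.1.2]).
  case: (pselect (open p.2 /\ p.2 p.1.2)) => [[o2 p2]|np].
    by have [W WP] := answer_II cC p.1.1 o2 p2; exists W.
  by exists set0 => o2 p2; case: np.
(* The state kept along a list of points is the number of points read and the
   last answer. *)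
pose step (q : nat * set X) (x : X) := (q.1.+1, W (q.1, x, q.2)).
exists (fun l => (foldl step (0%N, setT) l).2) => x.
pose q n := foldl step (0%N, setT) (mkseq x n).
have qS n : q n.+1 = step (q n) (x n) by rewrite /q mkseqS foldl_rcons.
have q1 n : (q n).1 = n by elim: n => // n IH; rewrite qS /= IH.
pose U n := (q n.+1).2; rewrite -/U.
(* [V n] is the set in which [x n] must be played. *)
pose V n := (q n).2.
have UE n : U n = W (n, x n, V n) by rewrite /U qS /= q1.
have VS n : V n.+1 = U n by [].
have V0 : V 0%N = setT by [].
have Vleg n : legal_before x U n -> legal_I x U n -> open (V n) /\ V n (x n).
  case: n => [_ _|n bn In]; first by rewrite V0; split=> //; exact: openT.
  by rewrite VS; split=> //; have [_ []] := bn n (ltnSn n).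
apply: wins_II_intro => [n bn In|lr].
  have [oV Vx] := Vleg _ bn In.
  by have [oW Wx _ _ _] := WP (n, x n, V n) oV Vx; split; rewrite UE.
have UP n : [/\ closure (U n) `<=` V n, U n `<=` mball d (x n) n.+1%:R^-1
    & forall y j, (j <= n)%N -> U n y -> C j y -> C j (x n)].
  have [oV Vx] := Vleg n (fun m _ => lr m) (lr n).1.
  by rewrite UE; have [] := WP (n, x n, V n) oV Vx.
have Ux n : U n (x n) by have [_ []] := lr n.
have US n : closure (U n.+1) `<=` U n by rewrite -VS; have [] := UP n.+1.
have Ule n m : (n <= m)%N -> U m `<=` U n.
  move=> /subnK <-; elim: (m - n)%N => // k IH.
  by apply: subset_trans IH; apply: subset_trans (US _); exact: subset_closure.
have [l xl] : exists l : X, x @ \oo --> l.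
  apply: dcomp => e e0; have [|n ne] := @natSinv_small R (e / 2); first by lra.
  exists n => i j ni nj; have [_ Un _] := UP n.
  have := Un _ (Ule _ _ ni _ (Ux i)); have := Un _ (Ule _ _ nj _ (Ux j)).
  have [_ _ /(_ (x i) (x n)) + /(_ (x i) (x n) (x j))] := dm.
  by move: ne; rewrite /mball/=; move: n.+1%:R^-1 => r; lra.
have Ul n : U n l.
  have xcl : \forall m \near \oo, closure (U n.+1) (x m).
    by exists n.+1 => // m /= nm; apply: subset_closure; exact: Ule nm _ (Ux m).
  by apply: US; exact: (closed_cvg _ (@closed_closure _ (U n.+1)) xcl l xl).
exists l => // V' /=; rewrite nbhsE => -[V1 [oV1 V1l] V1V'].
have [D [/NC[j <-] Cl CV1]] := Nnet _ _ oV1 V1l.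
exists j => // n /= jn; apply/V1V'/CV1.
by have [_ _ /(_ l j jn (Ul n) Cl)] := UP n.
Qed.

End WinII.

Section WinI.
Variables (R : realType) (X Y : topologicalType) (f : X -> Y) (dY : Y -> Y -> R).
Hypotheses (dm : is_metric dY) (dc : metric_compatible dY).

(** A set [F `&` U] on which [f] oscillates by more than [e] always contains a
    point whose image is at distance more than [e / 2] from a given value, by the
    triangle inequality. With steps of that size the images cannot
    eventually stay within [e / 4] of a limit. *)
Lemma large_osc_winning_I (e : R) (F : set X) : 0 < e -> F !=set0 ->
  (forall U, open U -> F `&` U !=set0 -> ~ osc_le dY f e (F `&` U)) ->
  has_winning_I f.
Proof.
move=> e0 [x0 Fx0] Fosc.
have [_ _ dsym dtri] := dm.
have [p|next nextP] := @choice (set X * X) X (fun p y =>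
    open p.1 -> F `&` p.1 !=set0 ->
    [/\ F y, p.1 y & e / 2 < dY (f p.2) (f y)]).
  case: (pselect (open p.1 /\ F `&` p.1 !=set0)) => [[o1 ne1]|np]; last first.
    by exists x0 => o1 ne1; case: np.
  apply: contrapT => noy; apply: (Fosc _ o1 ne1) => u v [Fu pu] [Fv pv].
  have far y : F y -> p.1 y -> dY (f p.2) (f y) <= e / 2.
    move=> Fy py; rewrite leNgt; apply/negP => lt_e.
    by apply: noy; exists y.
  have := far _ Fu pu; have := far _ Fv pv.
  have := dtri (f u) (f p.2) (f v); rewrite (dsym (f u) (f p.2)).
  lra.
pose s := foldl (fun y U => next (U, y)) x0.
exists s => U; set x := fun n => s (mkseq U n).
have xS n : x n.+1 = next (U n, x n) by rewrite /x /s mkseqS foldl_rcons.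
have nextx n : legal_II x U n -> F (x n) ->
    [/\ F (x n.+1), U n (x n.+1) & e / 2 < dY (f (x n)) (f (x n.+1))].
  move=> [oU Ux] Fx; rewrite xS; apply: (nextP (U n, x n)) => //.
  by exists (x n).
have Fx n : legal_before x U n -> F (x n).
  elim: n => [//|n IH] bn; have [_ IIn] := bn _ (ltnSn n).
  by have [] := nextx n IIn (IH (fun m mn => bn _ (ltnW mn))).
apply: wins_I_intro => [[//|n] bn|lr [l _ fl]].
  have [_ IIn] := bn _ (ltnSn n).
  by have [] := nextx n IIn (Fx _ (fun m mn => bn _ (ltnW mn))).
have e40 : 0 < e / 4 by lra.
have [n _ nP] := fl _ (nbhs_mball dm dc (f l) e40).
have := nP n (leqnn n); have := nP n.+1 (leqnSn n).
have [_ _] := nextx n (lr n).2 (Fx _ (fun m _ => lr m)).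
have := dtri (f (x n)) (f l) (f (x n.+1)).
by rewrite /mball/= (dsym (f (x n)) (f l)); lra.
Qed.

End WinI.

Theorem theorem7 (R : realType) (X Y : topologicalType)
    (polishX : polish_space R X) (polishY : polish_space R Y) (f : X -> Y) :
  determined f /\
  (has_winning_I f <-> ~ baire_class1 f) /\
  (has_winning_II f <-> baire_class1 f).
Proof.
case: polishX => [sepX [dX [mX cX compX]]]; case: polishY => [sepY [dY [mY cY _]]].
have [BX [cBX bBX]] := metric_countable_base mX cX sepX.
have [BY [cBY bBY]] := metric_countable_base mY cY sepY.
have win_II : baire_class1 f -> has_winning_II f.
  move=> /(baire1_network cBY bBY)[N netN].
  exact: closed_network_winning_II mX cX compX N netN.
have win_I : ~ baire_class1 f -> has_winning_I f.
  move=> nbf; apply: contrapT => noI; apply: nbf.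
  have [|N] := small_osc_network (f := f) cBX bBX (open_Fsigma mX cX) cY.
  - move=> e e0 F clF F0; apply: contrapT => noU; apply: noI.
    apply: (large_osc_winning_I mY cY e0 F0) => U oU FU oscU.
    by apply: noU; exists U.
  - exact: network_baire1.
have excl := @not_both_winning _ _ f.
case: (pselect (baire_class1 f)) => bf.
- have II := win_II bf.
  by split; [right|split; split=> // I; case: (excl I)].
- have I := win_I bf.
  by split; [left|split; split=> // /(excl I)].
Qed.
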